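(* Let $a,b,c$ be $F$-continuous real functions on $F\cap[a_0,b_0]$, with $c$ different from zero (that is, not identically zero), and suppose that $b:F\cap[a_0,b_0]\to\mathbb{R}$ is a positive function such that $b\in C^1(F\cap[a_0,b_0])$. Let $z(t)$ be a solution of the second-order fractal differential equation $$D^{2\alpha}_F z(t)=\left(\frac{D^{\alpha}_F b(t)}{b(t)}+a(t)\right)D^{\alpha}_F z(t)-b(t)c(t)z(t),\qquad \forall t\in F\cap[a_0,b_0].$$ Then the Riccati-type fractal differential equation $$D^{\alpha}_F y(t)=a(t)\,y(t)+b(t)\,y^2(t)+c(t),\qquad \forall t\in F\cap[a_0,b_0],$$ has an exact solution of the form $$y(t)=-\frac{D^{\alpha}_F z(t)}{b(t)z(t)},\qquad \forall t\in F\cap[a_0,b_0].$$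
   Context: Setting: $\alpha\in(0,1]$; $F\subset\mathbb{R}$ is a compact $\alpha$-perfect fractal set of fractal (Hausdorff) dimension $\alpha$; $[a_0,b_0]$ is an interval with $F\cap[a_0,b_0]\neq\emptyset$. Let $\mathcal{H}^\alpha$ be the $\alpha$-dimensional Hausdorff measure, $\mathcal{H}^\alpha(A)=\lim_{\delta\to0}\inf\{\sum_i(\mathrm{diam}A_i)^\alpha: A\subset\bigcup_i A_i,\ \mathrm{diam}A_i\le\delta\}$. Fix $p\in[a_0,b_0]$. The staircase function is $S^\alpha_F(t)=\Gamma(\alpha+1)\mathcal{H}^\alpha(F\cap[p,t])$ if $t\ge p$ and $S^\alpha_F(t)=-\Gamma(\alpha+1)\mathcal{H}^\alpha(F\cap[t,p])$ if $t<p$, where $\Gamma$ is the gamma function. That $F$ is $\alpha$-perfect means that $S^\alpha_F$ is finite and $F$ is exactly the set of points at which $S^\alpha_F$ is not locally constant, this set being closed and without isolated points. $F$-limit: $F\text{-}\lim_{y\to t} g(y)=\ell$ means the limit along $y\in F\cap[a_0,b_0]$, $y\ne t$: for every $\varepsilon>0$ there is $\delta>0$ with $|g(y)-\ell|<\varepsilon$ whenever $y\in F\cap[a_0,b_0]$, $0<|y-t|<\delta$. A function $f$ is $F$-continuous if $F\text{-}\lim_{y\to t}f(y)=f(t)$ for every $t\in F\cap[a_0,b_0]$. Fractal derivative: $D^\alpha_Ff(t)=F\text{-}\lim_{y\to t}\frac{f(y)-f(t)}{S^\alpha_F(y)-S^\alpha_F(t)}$ if $t\in F\cap[a_0,b_0]$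 (when this limit exists), and $D^\alpha_Ff(t)=0$ if $t\in[a_0,b_0]\setminus F$; at points of $F$ it depends only on the values of $f$ on $F\cap[a_0,b_0]$. $f$ is $F^\alpha$-derivable if it has a fractal derivative at every point. $f\in C^1(F\cap[a_0,b_0])$ means that $f$ is $F^\alpha$-derivable and $D^\alpha_Ff$ is $F$-continuous. If $D^\alpha_Ff$ is itself $F^\alpha$-derivable at $t$, then $D^{2\alpha}_Ff(t):=D^\alpha_F(D^\alpha_Ff)(t)$. A solution of a first-order (resp. second-order) fractal differential equation is a function whose fractal derivative $D^\alpha_F$ (resp. $D^\alpha_F$ and $D^{2\alpha}_F$) exists and which satisfies the equation at every point of $F\cap[a_0,b_0]$.
   Formalization: The solution z of the second-order equation is additionally assumed to have no zero on F∩[a_0,b_0]; without this the formula for y divides by zero and the claim fails (e.g. α=1, F=[0,4], a=0, b=c=1, z=cos t). *)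

(* Defs.v *)
From HB Require Import structures.
From mathcomp Require Import all_boot all_order all_algebra.
From mathcomp Require Import all_classical all_reals all_analysis.

Set Implicit Arguments.
Unset Strict Implicit.
Unset Printing Implicit Defensive.

Import Order.TTheory GRing.Theory Num.Theory.
Import numFieldNormedType.Exports.

Local Open Scope classical_set_scope.
Local Open Scope ring_scope.

Section HausdorffMeasure.
Context {R : realType}.
Implicit Types (s d : R) (A : set R).

(* The maximum with 0 gives the empty set diameter 0 (its supremum is -oo). *)
Definition diam A : \bar R :=
  maxe 0%E (ereal_sup [set (`|x.1 - x.2|)%:E | x in A `*` A]).

(* The covers are indexed by nat; for s > 0, finite covers are included by
   padding with empty sets, whose contribution is 0 `^ s = 0. *)
Definition hausdorff_content s d A : \bar R :=
  ereal_inf [set (\sum_(i <oo) (diam (U i) `^ s))%E | U in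
    [set U : nat -> set R |
      A `<=` \bigcup_i U i /\ forall i, (diam (U i) <= d%:E)%E]].

Definition hausdorff_measure s A : \bar R :=
  lim (hausdorff_content s d A @[d --> 0^'+]).

(* The infimum is over s > 0, since the measure of order 0 is not covered by
   the padding convention above; this does not change its value. *)
Definition hausdorff_dim A : \bar R :=
  ereal_inf [set s%:E | s in [set s | 0 < s /\ hausdorff_measure s A = 0%E]].

Definition Gamma (x : R) : R :=
  Rintegral lebesgue_measure `]0, +oo[ (fun u => u `^ (x - 1) * expR (- u)).

End HausdorffMeasure.

Section Staircase.
Context {R : realType}.
Variables (alpha : R) (F : set R) (p : R).

Definition staircase_ereal (t : R) : \bar R :=
  if p <= t
  then ((Gamma (alpha + 1))%:E * hausdorff_measure alpha (F `&` `[p, t]))%E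
  else (- ((Gamma (alpha + 1))%:E * hausdorff_measure alpha (F `&` `[t, p])))%E.

Definition staircase (t : R) : R := fine (staircase_ereal t).

Definition alpha_perfect : Prop :=
  [/\ (forall t, staircase_ereal t \is a fin_num),
      F = [set t | ~ \forall s \near t, staircase s = staircase t] &
      perfect_set F].

End Staircase.

Section FractalCalculus.
Context {R : realType}.
Variables (alpha : R) (F : set R) (a0 b0 p : R).
Implicit Types (f g : R -> R) (t l : R).

Definition Flim g t l : Prop :=
  g y @[y --> within (F `&` `[a0, b0]) t^'] --> l.

Definition Fcontinuous f : Prop :=
  forall t, (F `&` `[a0, b0]) t -> Flim f t (f t).

(* [Fderive f t l] reads "the fractal derivative of f at t is l", for t in
   [a0, b0].  It is a relation because an F-limit is not unique at a point that
   is isolated in F `&` `[a0, b0] (only a0 and b0 can be).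
   When F is alpha-perfect the denominator vanishes at no y of F close enough
   to t, apart from t, so the convention x / 0 = 0 does not affect the limit. *)
Definition Fderive f t l : Prop :=
  (F t -> Flim (fun y => (f y - f t) /
             (staircase alpha F p y - staircase alpha F p t)) t l) /\
  (~ F t -> l = 0).

Definition Fderivative f f' : Prop :=
  forall t, t \in `[a0, b0] -> Fderive f t (f' t).

Definition FC1 f : Prop := exists f', Fderivative f f' /\ Fcontinuous f'.

End FractalCalculus.

(* Main.v *)
Require Import Defs.
From HB Require Import structures.
From mathcomp Require Import all_boot all_order all_algebra.
From mathcomp Require Import all_classical all_reals all_analysis.
From mathcomp Require Import ring lra.

Set Implicit Arguments.
Unset Strict Implicit.
Unset Printing Implicit Defensive.

Import Order.TTheory GRing.Theory Num.Theory.
Import numFieldNormedType.Exports.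

Local Open Scope classical_set_scope.
Local Open Scope ring_scope.

(** The substitution y = - z' / (b z) linearizes the Riccati equation: the
quotient and product rules give
  y' = - z'' / (b z) + b' z' / (b^2 z) + b y^2,
and replacing z'' by its value turns the first two terms into a y + c.  All the
work is in showing that the fractal derivative obeys these two rules.

As for the ordinary derivative, they rest on the fact that a derivable
function is continuous along F.  From
f y - f t = ((f y - f t) / (S y - S t)) (S y - S t), where S is the staircase,
this needs two properties of S at a point t of F.

- S y tends to S t ([staircase_continuous]).  Up to a constant factor the
  increments of S are bounded by the Hausdorff measure of the part of F between
  t and y, so what is needed is that a set of finite Hausdorff measure has small
  measure near each point ([hausdorff_measure_ball_small]).  The measure is
  handled as an outer measure: countable subadditivity and additivity on sets
  at positive distance, as in Caratheodory's criterion, are enough.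

- S y differs from S t for y in F close to t, y <> t.  This holds because S is
  nondecreasing and F is the set where S is not locally constant
  ([nondecreasing_neq_near]): if S y = S t then S is constant between y and t,
  so F avoids the open interval between them. *)

(** * The Hausdorff measure as a metric outer measure *)

Section HausdorffTheory.
Context {R : realType}.
Implicit Types (s d e t : R) (A B : set R).
Local Open Scope ereal_scope.

Local Lemma diam_ge0 A : 0 <= diam A.
Proof. by rewrite /diam le_max lexx. Qed.

Local Lemma diam1 t : diam [set t] = 0.
Proof.
apply/eqP; rewrite eq_le diam_ge0 andbT /diam ge_max lexx/=.
by apply: ge_ereal_sup => _ [[x y] [/= -> ->]] <-; rewrite subrr normr0.
Qed.

Local Lemma diam0 : diam (set0 : set R) = 0.
Proof.
apply/eqP; rewrite eq_le diam_ge0 andbT /diam ge_max lexx/=.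
by apply: ge_ereal_sup => _ [[x y] [/= []]].
Qed.

Local Lemma dist_le_diam A x y : A x -> A y -> (`|x - y|)%:E <= diam A.
Proof.
move=> Ax Ay; rewrite /diam le_max; apply/orP; right.
by apply: ereal_sup_ubound; exists (x, y).
Qed.

(** The infinite weight encodes the restriction to sets of diameter at most
d, so that the content becomes the outer measure generated by a weight.  That
construction wants a weight on a semiring of sets; every set is measurable in
the sigma-algebra generated by all sets, so that no covering set is excluded. *)
Definition cover_weight s d : set (g_sigma_algebraType [set: set R]) -> \bar R :=
  fun U => if diam U <= d%:E then diam U `^ s else +oo.

Local Lemma cover_weight_ge0 s d U : 0 <= cover_weight s d U.
Proof. by rewrite /cover_weight; case: ifP => // _; exact: poweR_ge0. Qed.

Lemma hausdorff_contentE s d A :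
  hausdorff_content s d A = mu_ext (@cover_weight s d) A.
Proof.
have sum_fine U : (forall i, diam (U i) <= d%:E) ->
    \sum_(i <oo) cover_weight s d (U i) = \sum_(i <oo) (diam (U i) `^ s).
  by move=> Ud; apply: eq_eseriesr => i _; rewrite /cover_weight Ud.
apply/eqP; rewrite eq_le; apply/andP; split; apply: le_ereal_inf_tmp.
- move=> _ [U [_ AU] <-].
  have [Ud|/existsNP[i /negP Ui]] := pselect (forall i, diam (U i) <= d%:E).
    by apply: ereal_inf_lbound; exists U => //; rewrite sum_fine.
  rewrite (eseries_pinfty (k := i)) ?leey//.
    by move=> n _; rewrite -ltNye (lt_le_trans _ (cover_weight_ge0 _ _ _)).
  by rewrite /cover_weight (negbTE Ui).
- move=> _ [U [AU Ud] <-].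
  apply: ereal_inf_lbound; exists U; last exact: sum_fine.
  by split => // i; exact: sub_gen_smallest.
Qed.

Lemma le_hausdorff_content s d A B : A `<=` B ->
  hausdorff_content s d A <= hausdorff_content s d B.
Proof.
move=> AB; rewrite !hausdorff_contentE.
exact: (le_mu_ext (@cover_weight s d)).
Qed.

Lemma hausdorff_content_ge0 s d A : 0 <= hausdorff_content s d A.
Proof. by rewrite hausdorff_contentE mu_ext_ge0//; exact: cover_weight_ge0. Qed.

Lemma hausdorff_content_nonincreasing s A d e : (d <= e)%R ->
  hausdorff_content s e A <= hausdorff_content s d A.
Proof.
move=> de; apply: ereal_inf_le_tmp => _ [U [AU Ud] <-].
exists U => //; split => // i.
by rewrite (le_trans (Ud i))// lee_fin.
Qed.

(** The contents increase as d decreases, so the limit at 0 is a supremum;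
inequalities can then be proved at each scale d separately. *)
Lemma hausdorff_measure_sup s A : hausdorff_measure s A =
  ereal_sup [set hausdorff_content s d A | d in `]0%R, +oo[].
Proof.
apply/cvg_lim => //; apply: nonincreasing_at_right_cvge; first by [].
by move=> d e _ _; exact: hausdorff_content_nonincreasing.
Qed.

Lemma hausdorff_content_le_measure s d A : (0 < d)%R ->
  hausdorff_content s d A <= hausdorff_measure s A.
Proof.
move=> d0; rewrite hausdorff_measure_sup; apply: ereal_sup_ubound.
by exists d => //=; rewrite in_itv/= d0.
Qed.

Lemma hausdorff_measure_le s A x :
  (forall d, (0 < d)%R -> hausdorff_content s d A <= x) ->
  hausdorff_measure s A <= x.
Proof.
move=> Ax; rewrite hausdorff_measure_sup; apply: ge_ereal_sup => _ [d + <-].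
by rewrite /= in_itv/= andbT; exact: Ax.
Qed.

Lemma hausdorff_measure_ge0 s A : 0 <= hausdorff_measure s A.
Proof.
exact: le_trans (hausdorff_content_ge0 s 1 A) (hausdorff_content_le_measure _ _ _).
Qed.

Lemma le_hausdorff_measure s A B : A `<=` B ->
  hausdorff_measure s A <= hausdorff_measure s B.
Proof.
move=> AB; apply: hausdorff_measure_le => d d0.
apply: le_trans (hausdorff_content_le_measure s B d0).
exact: le_hausdorff_content.
Qed.

Lemma hausdorff_measure_sigma_subadditive s :
  sigma_subadditive (@hausdorff_measure R s).
Proof.
move=> A; apply: hausdorff_measure_le => d d0; rewrite hausdorff_contentE.
apply: (@le_trans _ _ (\sum_(i <oo) mu_ext (@cover_weight s d) (A i))).
  by apply: mu_ext_sigma_subadditive; exact: cover_weight_ge0.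
apply: lee_nneseries => [i _ _|i _]; rewrite -hausdorff_contentE.
  exact: hausdorff_content_ge0.
exact: hausdorff_content_le_measure.
Qed.

Lemma hausdorff_measure1 s t : (0 < s)%R -> hausdorff_measure s [set t] = 0.
Proof.
move=> s0; apply/eqP; rewrite eq_le hausdorff_measure_ge0 andbT.
apply: hausdorff_measure_le => d d0; apply: ereal_inf_lbound.
exists (fun=> [set t]) => /=.
  by split=> [x|_]; [exists 0%N|rewrite diam1 lee_fin ltW].
by apply: eseries0 => *; rewrite diam1 poweR0r// gt_eqF.
Qed.

Lemma hausdorff_measure0 s : (0 < s)%R -> hausdorff_measure s (set0 : set R) = 0.
Proof.
move=> s0; apply/eqP; rewrite eq_le hausdorff_measure_ge0 andbT.
by rewrite -(hausdorff_measure1 0 s0) le_hausdorff_measure.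
Qed.

Lemma hausdorff_measureU s A B : (0 < s)%R ->
  hausdorff_measure s (A `|` B) <= hausdorff_measure s A + hausdorff_measure s B.
Proof.
move=> s0; rewrite -bigcup2E.
apply: (le_trans (hausdorff_measure_sigma_subadditive s (bigcup2 A B))).
rewrite (nneseries_split _ 2)//; last by move=> *; exact: hausdorff_measure_ge0.
rewrite add0n eseries0 ?adde0; last first.
  by move=> [|[|i]]//= _ _; exact: hausdorff_measure0.
by rewrite big_mkord !big_ord_recr/= big_ord0 add0e.
Qed.

(** A set of diameter less than e meets at most one of A and B.  Hence a fine
cover of the union splits into a cover of A and a cover of B, without any set
being counted twice. *)
Lemma hausdorff_measure_separated s e A B : (0 < s)%R -> (0 < e)%R ->
  (forall x y, A x -> B y -> (e <= `|x - y|)%R) ->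
  hausdorff_measure s A + hausdorff_measure s B <= hausdorff_measure s (A `|` B).
Proof.
move=> s0 e0 sepAB.
(* The members of a cover that miss C are replaced by the empty set, which
   weighs nothing since s > 0. *)
pose trace U (C : set R) : set R := if `[< U `&` C !=set0 >] then U else set0.
have diam_trace U C : diam (trace U C) <= diam U.
  by rewrite /trace; case: ifP => // _; rewrite diam0 diam_ge0.
have sub_trace (U : nat -> set R) C : C `<=` \bigcup_i U i ->
    C `<=` \bigcup_i trace (U i) C.
  move=> CU x Cx; have [i _ Uix] := CU _ Cx; exists i => //.
  by rewrite /trace asboolT//; exists x.
have content_separated d : (0 < d < e)%R ->
    hausdorff_content s d A + hausdorff_content s d B <=
    hausdorff_content s d (A `|` B).
  move=> /andP[d0 de]; apply: le_ereal_inf_tmp => _ [U [ABU Ud] <-].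
  pose V C i := trace (U i) C.
  apply: (@le_trans _ _ (\sum_(i <oo) (diam (V A i) `^ s + diam (V B i) `^ s))).
    rewrite nneseriesD; try by move=> *; exact: poweR_ge0.
    have VP C : C `<=` A `|` B ->
        hausdorff_content s d C <= \sum_(i <oo) (diam (V C i) `^ s).
      move=> CAB; apply: ereal_inf_lbound; exists (V C) => //; split => [|i].
        by apply: sub_trace; exact: subset_trans CAB ABU.
      exact: le_trans (diam_trace _ _) (Ud i).
    by apply: leeD; apply: VP; [exact: subsetUl|exact: subsetUr].
  apply: lee_nneseries => i _; first by rewrite adde_ge0 ?poweR_ge0.
  rewrite /V /trace.
  case: asboolP => [[x [Ux Ax]]|_]; case: asboolP => [[y [Uy By]]|_];
    rewrite ?diam0 ?poweR0r ?gt_eqF// ?adde0 ?add0e ?poweR_ge0//.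
  have := le_trans (dist_le_diam Ux Uy) (Ud i).
  by rewrite lee_fin => /(le_trans (sepAB _ _ Ax By)); rewrite leNgt de.
have [d0 d1] : (0 < e / 2)%R /\ (e / 2 < e)%R by split; lra.
have small d : (0 < d)%R -> exists2 d', (0 < d' < e)%R & (d' <= d)%R.
  move=> d_gt0; exists (Num.min d (e / 2))%R; last by rewrite ge_min lexx.
  by rewrite lt_min d_gt0 d0 gt_min d1 orbT.
have bound d d' : (0 < d)%R -> (0 < d')%R ->
    hausdorff_content s d A + hausdorff_content s d' B <= hausdorff_measure s (A `|` B).
  move=> dp d'p; have [c ce] : exists2 c, (0 < c < e)%R & (c <= Num.min d d')%R.
    by apply: small; rewrite lt_min dp.
  rewrite le_min => /andP[cd cd'].
  apply: (@le_trans _ _ (hausdorff_content s c A + hausdorff_content s c B)).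
    by apply: leeD; exact: hausdorff_content_nonincreasing.
  apply: le_trans (content_separated _ ce) _.
  by apply: hausdorff_content_le_measure; case/andP: ce.
have [->|ABoo] := eqVneq (hausdorff_measure s (A `|` B)) +oo.
  by rewrite leey.
have [AU BU] := (@subsetUl _ A B, @subsetUr _ A B).
have finB : hausdorff_measure s B \is a fin_num.
  rewrite ge0_fin_numE ?hausdorff_measure_ge0//.
  by apply: le_lt_trans (le_hausdorff_measure s BU) _; rewrite ltey.
rewrite -leeBrDr//; apply: hausdorff_measure_le => d dp.
have finA : hausdorff_content s d A \is a fin_num.
  rewrite ge0_fin_numE ?hausdorff_content_ge0//.
  apply: le_lt_trans (hausdorff_content_le_measure _ _ dp) _.
  by apply: le_lt_trans (le_hausdorff_measure s AU) _; rewrite ltey.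
rewrite leeBrDr// addeC -leeBrDr//; apply: hausdorff_measure_le => d' d'p.
by rewrite leeBrDr// addeC; exact: bound.
Qed.

(** A is cut into thin rings around t.  Rings that are not adjacent are at
positive distance, so their measures add up to at most twice that of A (once for
each parity); the series of the measures converges, and by countable
subadditivity its tails bound the measure of the small balls, the centre having
measure 0. *)
Lemma hausdorff_measure_ball_small s A t : (0 < s)%R ->
  hausdorff_measure s A < +oo -> forall e, (0 < e)%R ->
  exists2 r, (0 < r)%R &
    hausdorff_measure s (A `&` [set x | (`|x - t| <= r)%R]) <= e%:E.
Proof.
move=> s0 Aoo e e0.
pose rad k : R := (k.+1%:R^-1)%R.
have rad_lt k : (rad k.+1 < rad k)%R by rewrite /rad ltf_pV2 ?posrE// ltr_nat.
have rad_gt0 k : (0 < rad k)%R by rewrite /rad.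
have rad_anti m n : (m <= n)%N -> (rad n <= rad m)%R.
  by move=> mn; rewrite /rad lef_pV2 ?posrE// ler_nat.
pose out k := A `&` [set x | (rad k < `|x - t|)%R].
pose ring k := A `&` [set x | (rad k.+2 < `|x - t| <= rad k.+1)%R].
pose H := @hausdorff_measure R s.
have H_ge0 B : 0 <= H B by exact: hausdorff_measure_ge0.
(* The ring of index k and the exterior region out k are separated by the ring
   between the radii rad k.+1 and rad k. *)
have ring_out k : H (ring k) + H (out k) <= H (out k.+2).
  have sep : (0 < rad k - rad k.+1)%R by rewrite subr_gt0.
  apply: le_trans (hausdorff_measure_separated s0 sep _) _.
    move=> x y [_ /= /andP[_ xk]] [_ /= yk].
    have : (`|y - t| <= `|x - y| + `|x - t|)%R.
      by rewrite (distrC x y) (le_trans _ (ler_normD _ _))// addrA subrK.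
    lra.
  apply: le_hausdorff_measure => x [[Ax /= /andP[]]//|[Ax /= xk]].
  split => //=; apply: le_lt_trans xk; apply: rad_anti.
  by rewrite -addn2 leq_addr.
(* Summing ring_out telescopes with step two, which leaves two terms. *)
have ring_sum n : \sum_(0 <= k < n) H (ring k) <= H (out n) + H (out n.+1).
  elim: n => [|n IH]; first by rewrite big_geq// adde_ge0.
  rewrite big_nat_recr//=; apply: le_trans (leeD2r _ IH) _.
  by rewrite [leLHS]addeAC addeC; apply: leeD => //; rewrite addeC.
have ring_series : \sum_(0 <= k <oo) H (ring k) < +oo.
  apply: (@le_lt_trans _ _ (H A + H A)); last exact: lte_add_pinfty.
  apply: lime_le; first by apply: is_cvg_nneseries.
  apply: nearW => n; apply: le_trans (ring_sum n) _.
  by apply: leeD; apply: le_hausdorff_measure => x [].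
have tail_cvg := nneseries_tail_cvg ring_series (fun k _ => H_ge0 (ring k)).
have [N tailN] : exists N, \sum_(N <= k <oo) H (ring k) <= e%:E.
  have /fine_cvgP[fin /cvgr0Pnorm_le/(_ _ e0) tail_le] := tail_cvg.
  near \oo => N; exists N.
  have finN : \sum_(N <= k <oo) H (ring k) \is a fin_num by near: N.
  rewrite -(fineK finN) lee_fin; apply: le_trans (ler_norm _) _.
  by near: N.
exists (rad N.+1) => //; apply: le_trans tailN.
rewrite -nneseries_addn//.
apply: le_trans (hausdorff_measure_sigma_subadditive _ (fun k => ring (k + N)%N)).
rewrite -[leRHS]add0e -(hausdorff_measure1 t s0).
apply: le_trans (hausdorff_measureU _ _ s0).
apply: le_hausdorff_measure => x [Ax /= xN].
have [->|xt] := eqVneq x t; [by left|right].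
have ex_rad : exists m, (rad m < `|x - t|)%R.
  have : (0 < `|x - t|)%R by rewrite normr_gt0 subr_eq0.
  by move=> /ltr_add_invr[m]; rewrite add0r => ?; exists m.
case: (ex_minnP ex_rad) => m xm m_min.
have Nm : (N.+1 < m)%N.
  by rewrite ltnNge; apply/negP => /rad_anti; lra.
(* m is the least index of a radius smaller than the distance from x to t, so x
   lies in the ring with outer radius rad m.-1. *)
have mE : (m - N.+2 + N).+2 = m by rewrite -2!addnS subnK.
exists (m - N.+2)%N => //; split => //=; rewrite mE xm/= leNgt.
by apply/negP => /m_min; rewrite -[leqLHS]mE ltnn.
Unshelve. all: by end_near. Qed.

End HausdorffTheory.

(** * The staircase function *)

Lemma Gamma_ge0 {R : realType} (x : R) : 0 <= Gamma x.
Proof.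
by apply: Rintegral_ge0 => u _; rewrite mulr_ge0 ?powR_ge0 ?expR_ge0.
Qed.

Section StaircaseTheory.
Context {R : realType}.
Variables (alpha : R) (F : set R) (p : R).
Hypothesis alpha_gt0 : 0 < alpha.
Hypothesis staircase_fin : forall t, staircase_ereal alpha F p t \is a fin_num.
Implicit Types u v t y : R.

Local Notation S := (staircase alpha F p).
Local Notation G := (Gamma (alpha + 1)).
Local Notation mass u v := (hausdorff_measure alpha (F `&` `[u, v])).

(** Finiteness is only assumed for the intervals with an endpoint at p, after
multiplication by the Gamma factor; a positive factor transfers it, and any
interval lies in the union of two such intervals. *)
Local Lemma mass_fin_num u v : 0 < G -> mass u v \is a fin_num.
Proof.
move=> G0; have finG x : (0 <= x)%E -> (G%:E * x)%E \is a fin_num -> x \is a fin_num.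
  by case: x => //= _; rewrite gt0_muley.
pose r : R := `|u - p| + `|v - p|.
have [pu pv] : p - u <= r /\ v - p <= r.
  have := ler_norm (p - u); rewrite distrC => pu; have := ler_norm (v - p).
  have := normr_ge0 (u - p); have := normr_ge0 (v - p).
  by rewrite /r => *; split; lra.
have r_ge0 : 0 <= r by rewrite addr_ge0.
have finr : mass p (p + r) \is a fin_num.
  apply: finG; first exact: hausdorff_measure_ge0.
  by have := staircase_fin (p + r); rewrite /staircase_ereal lerDl r_ge0.
have finl : mass (p - r) p \is a fin_num.
  apply: finG; first exact: hausdorff_measure_ge0.
  have := staircase_fin (p - r); rewrite /staircase_ereal.
  case: ifPn => [pr|_]; last by rewrite fin_numN.
  have -> : r = 0 by lra.
  by rewrite subr0.
rewrite ge0_fin_numE ?hausdorff_measure_ge0//.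
apply: (@le_lt_trans _ _ (mass (p - r)%R p + mass p (p + r)%R)%E); last first.
  by rewrite -ge0_fin_numE ?fin_numD ?finl// adde_ge0 ?hausdorff_measure_ge0.
apply: le_trans (hausdorff_measureU _ _ alpha_gt0).
apply: le_hausdorff_measure => x [Fx]; rewrite /= !in_itv/= => /andP[ux xv].
have [xp|px] := leP x p; [left|right]; split => //=; rewrite ?in_itv/=; lra.
Qed.

(** The factor 2 covers the case t < p <= y: there the increment is the sum of
the measures on the two sides of p, and each of them is at most the measure on
the whole interval. *)
Lemma staircase_increment t y : t <= y ->
  0 <= S y - S t <= 2 * G * fine (mass t y).
Proof.
move=> ty; have := Gamma_ge0 (alpha + 1); rewrite le_eqVlt => /predU1P[G0|G0].
  have S0 x : S x = 0.
    by rewrite /staircase /staircase_ereal -G0 !mul0e oppe0 if_same.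
  by rewrite !S0 -G0 mulr0 mul0r subrr lexx.
have fin u v := mass_fin_num u v G0.
have G_ge0 := ltW G0.
pose g u v : R := G * fine (mass u v).
have SE x : S x = if p <= x then g p x else - g x p.
  by rewrite /staircase /staircase_ereal /g; case: ifP => _; rewrite ?fineN fineM.
have g_ge0 u v : 0 <= g u v by rewrite mulr_ge0// fine_ge0// hausdorff_measure_ge0.
have g_mono u v u' v' : u' <= u -> v <= v' -> g u v <= g u' v'.
  move=> uu vv; apply: ler_wpM2l => //; apply: fine_le => //.
  apply: le_hausdorff_measure => x [Fx /=]; rewrite in_itv/= => xuv.
  by split => //=; rewrite in_itv/=; lra.
have g_add u v w : u <= v <= w -> g u w <= g u v + g v w.
  move=> uvw; rewrite -mulrDr; apply: ler_wpM2l => //.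
  rewrite -fineD//; apply: fine_le => //; first by rewrite fin_numD !fin.
  apply: le_trans (hausdorff_measureU _ _ alpha_gt0).
  apply: le_hausdorff_measure => x [Fx /=]; rewrite in_itv/= => xuw.
  by have [xv|vx] := leP x v; [left|right]; split => //=; rewrite ?in_itv/=; lra.
have gty := g_ge0 t y.
rewrite !SE -mulrA -/(g t y); clear SE fin; clearbody g.
have [py|yp] := leP p y; have [pt|tp] := leP p t.
- have := g_mono p t p y (lexx _) ty.
  by have := g_add p t y; rewrite pt ty => /(_ isT); lra.
- have := g_mono t p t y (lexx _) py; have := g_mono p y t y (ltW tp) (lexx _).
  by have := g_ge0 t p; have := g_ge0 p y; lra.
- by lra.
- have := g_mono y p t p ty (lexx _).
  by have := g_add t y p; rewrite ty ltW// => /(_ isT); lra.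
Qed.

Lemma staircase_nondecreasing : {homo S : t y / t <= y}.
Proof. by move=> t y /staircase_increment /andP[]; rewrite subr_ge0. Qed.

Lemma staircase_continuous : continuous S.
Proof.
move=> t; have := Gamma_ge0 (alpha + 1); rewrite le_eqVlt => /predU1P[G0|G0].
  have -> : S = cst 0.
    apply/funext => x.
    by rewrite /staircase /staircase_ereal -G0 !mul0e oppe0 if_same.
  exact: cvg_cst.
have G2 : 0 < 2 * G by rewrite mulr_gt0.
apply/cvgrPdist_le => e e0.
pose A := F `&` `[t - 1, t + 1].
have Aoo : (hausdorff_measure alpha A < +oo)%E.
  by rewrite -ge0_fin_numE ?mass_fin_num ?hausdorff_measure_ge0.
have [r r0 Ar] := hausdorff_measure_ball_small t alpha_gt0 Aoo (divr_gt0 e0 G2).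
have increment u v : t - Num.min r 1 <= u -> u <= v -> v <= t + Num.min r 1 ->
    u <= t <= v -> `|S v - S u| <= e.
  move=> tu uv vt utv; have /andP[S0 Sm] := staircase_increment uv.
  rewrite ger0_norm// (le_trans Sm)// mulrC -ler_pdivlMr//.
  rewrite -lee_fin fineK ?mass_fin_num//; apply: le_trans Ar.
  have [rr r1] : Num.min r 1 <= r /\ Num.min r 1 <= 1.
    by rewrite !ge_min !lexx orbT.
  apply: le_hausdorff_measure => x [Fx /=]; rewrite in_itv/= => xuv.
  by split; [split => //=; rewrite ?in_itv/=; lra|rewrite /= ler_distl; lra].
near=> y; have yt : `|y - t| <= Num.min r 1.
  near: y; apply: cvgr_distC_le; [exact: cvg_id|by rewrite lt_min r0 ltr01].
have r10 : 0 < Num.min r 1 by rewrite lt_min r0 ltr01.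
move: yt; rewrite ler_distl => yt.
have [ty|yt'] := leP t y; first by rewrite distrC; apply: increment; lra.
by apply: increment; lra.
Unshelve. all: by end_near. Qed.

End StaircaseTheory.

(** If f u = f t for some u < t, then f is constant on the interval from u to
t, hence locally constant at each of its inner points; otherwise f differs from
f t everywhere on the left of t.  The right side is symmetric. *)
Lemma nondecreasing_neq_near {R : realType} (f : R -> R) (t : R) :
  {homo f : x y / x <= y} ->
  \forall y \near t^', (~ \forall s \near y, f s = f y) -> f y != f t.
Proof.
move=> f_homo.
have flat u v y : u < y < v -> f u = f v -> \forall s \near y, f s = f y.
  move=> uyv fuv; have fE x : u < x < v -> f x = f u.
    move=> /andP[/ltW ux /ltW xv]; apply/eqP.
    by rewrite eq_le [leRHS]fuv !f_homo.
  have y_itv : y \in `]u, v[ by rewrite in_itv.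
  near=> s; rewrite (fE y)// fE//.
  have : s \in `]u, v[ by near: s; exact: near_in_itvoo.
  by rewrite in_itv.
have [u ut left_neq] : exists2 u, u < t & forall y, u < y < t ->
    (~ \forall s \near y, f s = f y) -> f y != f t.
  have [[u ut fut]|noflat] := pselect (exists2 u, u < t & f u = f t).
    by exists u => // y uyt []; exact: flat uyt fut.
  exists (t - 1) => [|y /andP[_ yt] _]; first lra.
  by apply/eqP => fyt; apply: noflat; exists y.
have [v tv right_neq] : exists2 v, t < v & forall y, t < y < v ->
    (~ \forall s \near y, f s = f y) -> f y != f t.
  have [[v tv fvt]|noflat] := pselect (exists2 v, t < v & f v = f t).
    by exists v => // y tyv []; exact: flat tyv (esym fvt).
  exists (t + 1) => [|y /andP[ty _] _]; first lra.
  by apply/eqP => fyt; apply: noflat; exists y.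
have t_itv : t \in `]u, v[ by rewrite in_itv/= ut.
near=> y; have : y \in `]u, v[ by near: y; apply: nbhs_dnbhs; exact: near_in_itvoo.
have : y != t by near: y; exact: nbhs_dnbhs_neq.
rewrite in_itv/= neq_lt => /orP[yt|ty] /andP[uy yv].
  by apply: left_neq; rewrite uy.
by apply: right_neq; rewrite ty.
Unshelve. all: by end_near. Qed.

(** * Rules of fractal differentiation *)

Section FractalDerivative.
Context {R : realType}.
Variables (alpha : R) (F : set R) (a0 b0 p : R).
Hypothesis alpha_gt0 : 0 < alpha.
Hypothesis F_perfect : alpha_perfect alpha F p.
Implicit Types (f g : R -> R) (t l m : R).

Local Notation S := (staircase alpha F p).
Local Notation quotient f t := (fun y => (f y - f t) / (S y - S t)).
Local Notation Flim := (Flim F a0 b0).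
Local Notation Fderive := (Fderive alpha F a0 b0 p).

(** A function with a fractal derivative at t is continuous at t along F: near
t its increment is the difference quotient, which converges, times the increment
of the staircase, which tends to 0 without vanishing. *)
Lemma Fderive_Flim f t l : F t -> Fderive f t l -> Flim f t (f t).
Proof.
case: F_perfect => S_fin F_E _ Ft [/(_ Ft) fl _].
have St : Flim S t (S t).
  apply: cvg_within_filter; apply/continuous_withinNx.
  exact: staircase_continuous alpha_gt0 S_fin t.
have Sneq : \forall y \near within (F `&` `[a0, b0]) t^', S y != S t.
  have S_homo := staircase_nondecreasing alpha_gt0 S_fin.
  apply: filterS (nondecreasing_neq_near t S_homo) => y Sy [Fy _].
  by apply: Sy; move: Fy; rewrite [X in X y]F_E.
have : Flim (fun y => f t + quotient f t y * (S y - S t)) t (f t).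
  rewrite /Defs.Flim -[X in _ --> X]addr0 -[X in _ + X](mulr0 l) -(subrr (S t)).
  apply: cvgD; first exact: cvg_cst.
  by apply: cvgM => //; apply: cvgB => //; exact: cvg_cst.
apply: cvg_trans; apply: near_eq_cvg; near=> y.
have Sy : S y - S t != 0 by rewrite subr_eq0; near: y.
by rewrite divfK// addrC subrK.
Unshelve. all: by end_near. Qed.

Lemma FderiveN f t l : Fderive f t l -> Fderive (fun y => - f y) t (- l).
Proof.
move=> [fl fl0]; split=> [Ft|/fl0 ->]; last exact: oppr0.
have -> : quotient (fun y => - f y) t = (fun y => - quotient f t y).
  by apply/funext => y; ring.
exact: cvgN (fl Ft).
Qed.

(** The rules are stated at points of F, since elsewhere the derivative is 0 by
convention. *)
Lemma FderiveM f g t l m : F t -> Fderive f t l -> Fderive g t m ->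
  Fderive (fun y => f y * g y) t (l * g t + f t * m).
Proof.
move=> Ft fl gm; have g_lim := Fderive_Flim Ft gm.
split=> [_|//]; have [f_lim gq_lim] := (fl.1 Ft, gm.1 Ft).
have -> : quotient (fun y => f y * g y) t =
    (fun y => quotient f t y * g y + f t * quotient g t y).
  by apply/funext => y /=; ring.
by apply: cvgD; apply: cvgM => //; exact: cvg_cst.
Qed.

Lemma Fderive_div f g t l m : F t -> g t != 0 ->
  Fderive f t l -> Fderive g t m ->
  Fderive (fun y => f y / g y) t ((l * g t - f t * m) / g t ^+ 2).
Proof.
move=> Ft gt0 fl gm; have g_lim := Fderive_Flim Ft gm.
split=> [_|//]; have [fq_lim gq_lim] := (fl.1 Ft, gm.1 Ft).
have : Flim (fun y => (quotient f t y * g t - f t * quotient g t y) /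
    (g y * g t)) t ((l * g t - f t * m) / g t ^+ 2).
  apply: cvgM; first by apply: cvgB; apply: cvgM => //; exact: cvg_cst.
  rewrite expr2; apply: cvgV; first by rewrite mulf_neq0.
  by apply: cvgM => //; exact: cvg_cst.
apply: cvg_trans; apply: near_eq_cvg; near=> y.
have gy0 : g y != 0 by near: y; exact: cvgr_neq0 g_lim gt0.
(* When the increment of S vanishes both sides are 0, by x / 0 = 0. *)
have [->|Sy] := eqVneq (S y - S t) 0.
  by rewrite invr0 !mulr0 mul0r subrr mul0r.
by field; rewrite Sy gt0 gy0.
Unshelve. all: by end_near. Qed.

End FractalDerivative.

(** * The Riccati equation *)

Theorem proposition4p3 (R : realType) (alpha : R) (F : set R) (a0 b0 p : R)
    (alpha_gt0 : 0 < alpha) (alpha_le1 : alpha <= 1)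
    (F_compact : compact F)
    (F_dim : hausdorff_dim F = alpha%:E)
    (F_meets : F `&` `[a0, b0] !=set0)
    (p_in : p \in `[a0, b0])
    (F_perfect : alpha_perfect alpha F p)
    (a b c : R -> R)
    (a_cont : Fcontinuous F a0 b0 a)
    (b_cont : Fcontinuous F a0 b0 b)
    (c_cont : Fcontinuous F a0 b0 c)
    (c_neq0 : exists2 t, (F `&` `[a0, b0]) t & c t != 0)
    (b_gt0 : forall t, (F `&` `[a0, b0]) t -> 0 < b t)
    (b_C1 : FC1 alpha F a0 b0 p b)
    (Db : R -> R) (Db_b : Fderivative alpha F a0 b0 p b Db)
    (z Dz D2z : R -> R)
    (Dz_z : Fderivative alpha F a0 b0 p z Dz)
    (D2z_z : Fderivative alpha F a0 b0 p Dz D2z)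
    (z_eq : forall t, (F `&` `[a0, b0]) t ->
      D2z t = (Db t / b t + a t) * Dz t - b t * c t * z t)
    (z_neq0 : forall t, (F `&` `[a0, b0]) t -> z t != 0) :
  exists y Dy : R -> R,
    [/\ (forall t, (F `&` `[a0, b0]) t -> y t = - (Dz t / (b t * z t))),
        Fderivative alpha F a0 b0 p y Dy &
        forall t, (F `&` `[a0, b0]) t ->
          Dy t = a t * y t + b t * y t ^+ 2 + c t].
Proof.
pose K := F `&` `[a0, b0].
pose y t := - (Dz t / (b t * z t)).
(* Off F, the derivative of y has to be 0. *)
exists y, (fun t => if `[< K t >] then a t * y t + b t * y t ^+ 2 + c t else 0).
split => // [t tab|t Kt]; last by rewrite asboolT.
have [Ft|nFt] := pselect (F t); last first.
  by split=> // _; rewrite asboolF// => -[].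
have Kt : K t by [].
have bt0 : b t != 0 by rewrite gt_eqF// b_gt0.
have zt0 : z t != 0 by exact: z_neq0.
have bz0 : b t * z t != 0 by rewrite mulf_neq0.
have Dbz := FderiveM alpha_gt0 F_perfect Ft (Db_b _ tab) (Dz_z _ tab).
have := FderiveN (Fderive_div alpha_gt0 F_perfect Ft bz0 (D2z_z _ tab) Dbz).
rewrite asboolT//; congr (Fderive _ _ _ _ _ _ _ _).
by rewrite /y z_eq//=; field; rewrite bt0 zt0.
Qed.
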